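(* Let $v\in(0,1]$. For $u\in\mathbb{N}$, the Gerber-Shiu function $\widehat{\phi}(u)$ of the dual risk process is given by $$\widehat{\phi}(u)=\boldsymbol{\alpha}^\top\mathbf{G}_v^{u}\,\boldsymbol{e},$$ where $\boldsymbol{\alpha}^\top$ is the initial distribution of the phase process $\{J_n\}_{n\in\mathbb{N}}$.
   Context: $\mathbb{N}=\{0,1,2,\dots\}$, $E=\{1,\dots,N\}$, $\boldsymbol{e}$ = column vector of ones. The phase process $\{J_n\}_{n\in\mathbb{N}}$ is an irreducible, positive recurrent homogeneous Markov chain on $E$ with stationary distribution $\boldsymbol{\pi}$ and initial distribution $\alpha_i=\mathbb{P}(J_0=i)$. The $\mathbb{N}$-valued variables $Z_k$, $k\ge1$, satisfy: given the past up to time $k-1$ and $J_{k-1}=i$, $(Z_k,J_k)$ has law $\lambda_{ij}(m)=\mathbb{P}(Z_1=m,J_1=j\mid J_0=i)$, $m\ge0$, with $\mathbb{E}(Z_1\mathbb{I}_{(J_1=j)}\mid J_0=i)<\infty$. Put $(\mathbf{A}_m)_{ij}=\lambda_{ij}(1-m)$ for $m\le1$ and $\mathbf{A}_m=\mathbf{0}$ for $m\ge2$; $\mathbf{A}_1$ is assumed non-singular. The regular process $X_n=X_0+n-\sum_{k=1}^nZ_k$ together with $J$ is an upward skip-free Markov additive chain with increment matrices $(\mathbf{A}_m)_{ij}=\mathbb{P}(X_1-X_0=m,J_1=j\mid J_0=i)$. Let $\tau_1^+=\inf\{n\ge0:X_n\ge1\}$; the matrix $\mathbf{G}_v$ has $(i,j)$-th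 element $\mathbb{E}(v^{\tau_1^+}\mathbb{I}_{(\tau_1^+<\infty,\,J_{\tau_1^+}=j)}\mid X_0=0,J_0=i)$. The dual risk process $\{\widehat U_n\}$ has $\widehat U_0=u$ and increments distributed as the negatives of the increments of the regular process (unit losses, random gains): $\widehat U_n=u-n+\sum_{k=1}^nZ_k$ with the same phase process $J$. For the dual process the net profit condition $\boldsymbol{\pi}^\top\sum_{m\ge-1}m\mathbf{A}_{-m}\boldsymbol{e}>0$ is assumed, so that $\widehat U_n\to+\infty$. The ruin time is $\widehat\tau_0=\inf\{n\in\mathbb{N}:\widehat U_n\le0\}$ ($\inf\emptyset=\infty$). The Gerber-Shiu function of the dual process is $\widehat\phi(u)=\boldsymbol{\alpha}^\top\widehat{\mathbf{\Phi}}(u)\boldsymbol{e}$, where $\widehat{\mathbf{\Phi}}(u)$ has $(i,j)$-th element $$\widehat\phi_{ij}(u)=\mathbb{E}\left[v^{\widehat\tau_0}\mathbb{I}_{(\widehat\tau_0<\infty,\,J_{\widehat\tau_0}=j)}\,\middle|\,J_0=i,\widehat U_0=u\right].$$ *)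

(* Defs.v *)
From HB Require Import structures.
From mathcomp Require Import all_boot all_order all_algebra.
From mathcomp Require Import all_classical all_reals all_analysis.

Set Implicit Arguments.
Unset Strict Implicit.
Unset Printing Implicit Defensive.

Import Order.TTheory GRing.Theory Num.Theory numFieldNormedType.Exports.
Local Open Scope classical_set_scope.
Local Open Scope ring_scope.

(* The phase space E is 'I_N.  Conditioning on
   J_0 = i is expressed by a family Pi of probability measures: Pi i is the law
   P( . | J_0 = i), which is needed for every i in E, including those i with
   P(J_0 = i) = 0.  The initial levels X_0 and U_0 are deterministic, so that
   conditioning on their value is fixing a parameter. *)

(* infinity is None *)
Definition first_time (Q : nat -> Prop) : option nat :=
  if pselect (exists n, `[< Q n >]) is left exQ then Some (ex_minn exQ)
  else None.

Section MarkovAdditive.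
Context (d : measure_display) (T : measurableType d) (R : realType) (N : nat).
Context (Pr : probability T R) (Pi : 'I_N -> probability T R).
Context (J : nat -> T -> 'I_N) (Z : nat -> T -> nat).

(* Only the Z k with k >= 1 are used. *)
Definition measurable_JZ : Prop :=
  (forall n j, measurable [set w | J n w = j]) /\
  (forall k m, (1 <= k)%N -> measurable [set w | Z k w = m]).

Definition initial_distribution : 'cV[R]_N :=
  \col_i fine (Pr [set w | J 0%N w = i]).

Definition conditional_laws : Prop :=
  (forall i, Pi i [set w | J 0%N w = i] = 1%E) /\
  (forall i (B : set T), measurable B ->
     (Pr (B `&` [set w | J 0%N w = i]) =
      Pr [set w | J 0%N w = i] * Pi i B)%E).

Definition lambda (i j : 'I_N) (m : nat) : R :=
  fine (Pi i [set w | Z 1%N w = m /\ J 1%N w = j]).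

Definition past (n : nat) (s : nat -> 'I_N) (z : nat -> nat) : set T :=
  [set w | (forall k, (k <= n)%N -> J k w = s k) /\
           (forall k, (1 <= k <= n)%N -> Z k w = z k)].

(* P(past, Z_(n+1) = m, J_(n+1) = j) = P(past) * lambda_(J_n, j)(m): the
   conditioning is on trajectories, in product form so that null ones are
   allowed. *)
Definition markov_additive : Prop :=
  forall (i : 'I_N) (n : nat) (s : nat -> 'I_N) (z : nat -> nat)
         (m : nat) (j : 'I_N),
    (Pi i (past n s z `&` [set w | Z n.+1 w = m /\ J n.+1 w = j]) =
     Pi i (past n s z) * (lambda (s n) j m)%:E)%E.

Definition finite_mean_increments : Prop :=
  forall i j : 'I_N,
    ('E_(Pi i)[fun w => ((Z 1%N w)%:R * (J 1%N w == j)%:R)%R] < +oo)%E.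

Definition transition_matrix : 'M[R]_N :=
  \matrix_(i, j) fine (Pi i [set w | J 1%N w = j]).

Definition irreducible_chain : Prop :=
  forall i j : 'I_N, exists n, (0 < Pi i [set w | J n w = j])%E.

Definition return_time (i : 'I_N) (w : T) : \bar R :=
  if first_time (fun n => (1 <= n)%N /\ J n w = i) is Some n
  then n%:R%:E else +oo%E.

Definition positive_recurrent : Prop :=
  forall i : 'I_N, (\int[Pi i]_w return_time i w < +oo)%E.

Definition stationary_distribution (pi : 'cV[R]_N) : Prop :=
  [/\ forall i, 0 <= pi i 0, \sum_i pi i 0 = 1
    & pi^T *m transition_matrix = pi^T].

Definition A_ (m : int) : 'M[R]_N :=
  \matrix_(i, j) if m <= 1 then lambda i j `|1 - m|%N else 0.

(* \sum_(m >= -1) m A_(-m), entrywise, with m = k - 1 for k in nat *)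
Definition dual_drift : 'M[R]_N :=
  \matrix_(i, j)
    limn (series (fun k : nat =>
      (k%:Z - 1)%:~R * A_ (- (k%:Z - 1)) i j : R)).

Definition net_profit_dual (pi : 'cV[R]_N) : Prop :=
  0 < (pi^T *m dual_drift *m const_mx 1 : 'M[R]_1) 0 0.

Definition Xreg (x0 : int) (n : nat) (w : T) : int :=
  x0 + n%:Z - (\sum_(1 <= k < n.+1) Z k w)%N%:Z.

Definition tau1 (x0 : int) (w : T) : option nat :=
  first_time (fun n => 1 <= Xreg x0 n w).

Definition Uhat (u : int) (n : nat) (w : T) : int :=
  u - n%:Z + (\sum_(1 <= k < n.+1) Z k w)%N%:Z.

Definition tauhat (u : int) (w : T) : option nat :=
  first_time (fun n => Uhat u n w <= 0).

(* v^tau 1(tau < oo, J_tau = j) *)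
Definition discounted_indicator (v : R) (tau : T -> option nat) (j : 'I_N)
    (w : T) : R :=
  if tau w is Some n then v ^+ n * (J n w == j)%:R else 0.

Definition G_ (v : R) : 'M[R]_N :=
  \matrix_(i, j) fine ('E_(Pi i)[discounted_indicator v (tau1 0) j])%E.

Definition Phihat (v : R) (u : int) : 'M[R]_N :=
  \matrix_(i, j) fine ('E_(Pi i)[discounted_indicator v (tauhat u) j])%E.

Definition phihat (v : R) (u : int) : R :=
  (initial_distribution^T *m Phihat v u *m const_mx 1 : 'M[R]_1) 0 0.

End MarkovAdditive.

(* Main.v *)
Require Import Defs.
From HB Require Import structures.
From mathcomp Require Import all_boot all_order all_algebra.
From mathcomp Require Import all_classical all_reals all_analysis.
From mathcomp Require Import measurable_realfun zify.

Set Implicit Arguments.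
Unset Strict Implicit.
Unset Printing Implicit Defensive.

Import Order.TTheory GRing.Theory Num.Theory.
Local Open Scope ring_scope.

(** Reflecting levels turns ruin of the dual process started at [u] into the
first visit of the regular process, started at 0, to the levels from [u] on; in
particular [tau1 0] is [tauhat 1] (lemma [tau1_tauhat]).  The regular process
moves up by at most one unit at a time, so on its way to level [x + 1] it passes
exactly through level 1, and from there it has [x] levels to climb, starting in
the phase reached there.  Hence the discounted transforms satisfy
[Phihat (x + 1) = G *m Phihat x] (lemma [PhihatS]), and [Phihat 0] is the
identity.

The strong Markov property behind this is obtained without shifting the
underlying space.  Let [L m] be the matrix of the [lambda i j m].  A first-step
analysis suggests the matrices [hitmx n x] of the probabilities to pass level
[x] for the first time at step [n], which are finite sums because a passage at
step [n] leaves no room for a claim larger than [n].  Lemma [past_hit_after]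
shows, by induction on [n] for all pasts at once, that given the trajectory up
to any time [k], the conditional probability of a first passage [n] steps later
is an entry of [hitmx n x].  The recursion alone then gives the convolution
identity [hitmxD], and the Cauchy product of power series in [v] turns the
convolution into a product of matrices. *)

(** * First times and first passages *)

Lemma first_timeP (Q : nat -> Prop) n :
  first_time Q = Some n <-> Q n /\ forall r, (r < n)%N -> ~ Q r.
Proof.
rewrite /first_time; case: pselect => [exQ|nexQ]; last first.
  by split=> // -[Qn _]; case: nexQ; exists n; exact/asboolP.
case: ex_minnP => m /asboolP Qm minm; split=> [[<-]|[Qn minn]].
  split=> // r rm Qr; have := minm r (introT (asboolP _) Qr).
  by rewrite leqNgt rm.
have mn : (m <= n)%N by apply: minm; exact/asboolP.
congr Some; apply/eqP; rewrite eqn_leq mn /= leqNgt.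
by apply/negP => /minn; apply.
Qed.

Lemma eq_first_time (Q Q' : nat -> Prop) :
  (forall n, Q n <-> Q' n) -> first_time Q = first_time Q'.
Proof. by move=> QQ'; congr first_time; apply/funext => n; exact/propext. Qed.

(** Over a fixed claim sequence [z], the passage at time [k + n] above a level
that lies [x] above the current one, at time [k].  Each step climbs one level
and the claim pushes the target [z k.+1] further away, so only natural numbers
occur and the target cannot be overshot. *)
Fixpoint first_passage (z : nat -> nat) (k n x : nat) : bool :=
  match n, x with
  | 0, 0 => true
  | n'.+1, x'.+1 => first_passage z k.+1 n' (x' + z k.+1)
  | _, _ => false
  end.

Lemma first_passageP z k n x : first_passage z k n x <->
  (x + \sum_(k.+1 <= i < k.+1 + n) z i = n)%N /\
  forall r, (r < n)%N -> (r < x + \sum_(k.+1 <= i < k.+1 + r) z i)%N.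
Proof.
elim: n k x => [|n IHn] k [|x] /=.
- by split=> // _; split=> //; rewrite addn0 big_geq.
- by split=> // -[]; rewrite addn0 big_geq.
- by split=> // -[_ /(_ 0%N isT)]; rewrite addn0 big_geq.
(* the first claim of the block is absorbed in the distance to the target *)
have step r : (x.+1 + \sum_(k.+1 <= i < k.+1 + r.+1) z i =
    (x + z k.+1 + \sum_(k.+2 <= i < k.+2 + r) z i).+1)%N.
  by rewrite big_ltn ?addnS ?addSn ?ltnS ?leq_addr// addnA.
rewrite IHn step; split=> -[e lt]; split; try lia.
  by case=> [|r] ?; rewrite ?step ?addSn// ltnS lt.
by move=> r rn; rewrite -ltnS -step lt.
Qed.

Section Level.
Context (d : measure_display) (T : measurableType d) (Z : nat -> T -> nat).

(** The recursion asks for the level to be hit exactly, [tauhat] only for it to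
be passed: upward skip-freeness makes the two agree. *)
Lemma tauhatP (x n : nat) (w : T) :
  tauhat Z x w = Some n <-> first_passage (Z^~ w) 0 n x.
Proof.
have UE r : Uhat Z x r w <= 0 <-> (x + \sum_(1 <= k < 1 + r) Z k w <= r)%N.
  by rewrite /Uhat add1n; split; lia.
rewrite /tauhat first_timeP first_passageP; split=> -[].
- rewrite UE => le lt.
  have {}lt r : (r < n)%N -> (r < x + \sum_(1 <= i < 1 + r) Z i w)%N.
    by move=> /lt; rewrite UE ltnNge => /negP.
  split=> //; apply/eqP; rewrite eqn_leq le /=.
  (* the level is not yet reached at time n - 1, and step n adds one unit *)
  case: n le lt => [//|n] _ /(_ n (ltnSn n)) lt; rewrite (leq_trans lt)//.
  by rewrite leq_add2l addnS [leqRHS]big_nat_recr//= leq_addr.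
- move=> e lt; split=> [|r rn]; first by rewrite UE e.
  by rewrite UE leqNgt lt.
Qed.

Lemma tau1_tauhat : tau1 Z 0 = tauhat Z 1.
Proof.
apply/funext => w; apply: eq_first_time => n.
by rewrite /Xreg /Uhat; split; lia.
Qed.

End Level.

(** * First-passage matrices and their convolution *)

Section Algebra.
Context (R : numDomainType) (N : nat) (L : nat -> 'M[R]_N).

Fixpoint hitmx (n x : nat) : 'M[R]_N :=
  match n, x with
  | 0, 0 => 1%:M
  | n'.+1, x'.+1 => \sum_(m < n'.+1) L m *m hitmx n' (x' + m)
  | _, _ => 0
  end.

Lemma hitmx_small n x : (n < x)%N -> hitmx n x = 0.
Proof.
elim: n x => [|n IHn] [|x] //= nx; apply: big1 => m _.
by rewrite IHn ?mulmx0// -ltnS (leq_trans nx)// ltnS leq_addr.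
Qed.

(** The range of the claim can be enlarged at will, since a claim larger than
the remaining number of steps puts the target out of reach; this lets all terms
of a convolution be summed over a common range. *)
Lemma hitmxSS M n x : (n < M)%N ->
  hitmx n.+1 x.+1 = \sum_(m < M) L m *m hitmx n (x + m).
Proof.
move=> nM /=; rewrite (big_ord_widen M (fun m => L m *m hitmx n (x + m)))//.
rewrite [RHS](bigID (fun m : 'I_M => (m < n.+1)%N))/= [X in _ + X]big1 ?addr0//.
by move=> m; rewrite -leqNgt => nm; rewrite hitmx_small ?mulmx0//; lia.
Qed.

(** Climbing [x + y] levels is climbing [x], at some step [k], and then [y].
The first step of the whole climb is also the first step of its [x]-part, so
both sides obey the same recursion in [n]. *)
Lemma hitmxD n x y :
  hitmx n (x + y) = \sum_(k < n.+1) hitmx k x *m hitmx (n - k) y.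
Proof.
elim: n x => [|n IHn] [|x].
- by rewrite big_ord1 mul1mx.
- by rewrite big_ord1 mul0mx addSn.
- rewrite big_ord_recl/= mul1mx big1 ?addr0// => k _.
  by rewrite mul0mx.
rewrite addSn big_ord_recl mul0mx add0r [LHS]/=.
under eq_bigr do rewrite addnAC IHn mulmx_sumr.
rewrite exchange_big; apply: eq_bigr => k _ /=.
rewrite -/(hitmx k.+1 x.+1) (@hitmxSS n.+1)// mulmx_suml subSS.
by apply: eq_bigr => m _; rewrite mulmxA.
Qed.

Context (L0 : forall m i j, 0 <= L m i j).
Lemma hitmx_ge0 n x i j : 0 <= hitmx n x i j.
Proof.
elim: n x i => [|n IHn] [|x] i /=; rewrite ?mxE ?ler0n//.
rewrite summxE sumr_ge0// => m _; rewrite mxE sumr_ge0// => l _.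
by rewrite mulr_ge0.
Qed.
End Algebra.

(** * Cauchy products of nonnegative series *)

Section Cauchy.
Local Open Scope ereal_scope.
Context (R : realType).

Lemma nneseries_finite_support (f : nat -> \bar R) n :
  (forall k, 0 <= f k) -> (forall k, (n <= k)%N -> f k = 0) ->
  \sum_(k <oo) f k = \sum_(k < n) f k.
Proof.
move=> f0 fn; rewrite (nneseries_split 0 n)// add0n [X in _ + X]eseries0 ?adde0.
  by rewrite big_mkord.
by move=> k nk _; exact: fn.
Qed.

(** Tonelli on the triangle [k <= n], then the shift [n := n + k] in the inner
sum.  The finiteness of the second series allows it to be treated as a real
factor. *)
Lemma nneseries_cauchy_product (a b : nat -> R) :
  (forall n, 0 <= a n)%R -> (forall n, 0 <= b n)%R ->
  \sum_(n <oo) (b n)%:E \is a fin_num ->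
  \sum_(n <oo) (\sum_(k < n.+1) a k * b (n - k)%N)%R%:E =
  (\sum_(n <oo) (a n)%:E) * (\sum_(n <oo) (b n)%:E).
Proof.
move=> a0 b0 bfin.
pose c k n := if (k <= n)%N then (a k * b (n - k)%N)%:E else 0.
have c0 k n : 0 <= c k n by rewrite /c; case: ifP; rewrite // lee_fin mulr_ge0.
transitivity (\sum_(n <oo) \sum_(k <oo) c k n).
  apply: eq_eseriesr => n _; rewrite (@nneseries_finite_support _ n.+1)//.
    by rewrite -sumEFin; apply: eq_bigr => k _; rewrite /c -ltnS ltn_ord.
  by move=> k nk; rewrite /c leqNgt nk.
rewrite nneseries_interchange//.
rewrite -(fineK bfin) muleC -nneseriesZl => [|n _]; last by rewrite lee_fin.
apply: eq_eseriesr => k _; rewrite muleC fineK//.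
rewrite -nneseriesZl => [|n _]; last by rewrite lee_fin.
rewrite (nneseries_split 0 k)// big1_seq ?add0e => [|n]; last first.
  by rewrite mem_index_iota /c => /andP[_ /andP[_ nk]]; rewrite leqNgt nk.
rewrite add0n -nneseries_addn//; apply: eq_eseriesr => n _.
by rewrite /c leq_addl addnK EFinM.
Qed.
End Cauchy.

(** * The law of the first passage *)

Section Probability.
Local Open Scope classical_set_scope.

Lemma measure_partition (d : measure_display) (T : measurableType d)
    (R : realType) (mu : {measure set T -> \bar R}) (I : finType)
    (g : T -> I) (B : set T) :
  (forall i, measurable (B `&` [set w | g w = i])) ->
  (mu B = \sum_(i : I) mu (B `&` [set w | g w = i]))%E.
Proof.
move=> mB; transitivity (mu (\bigcup_i (B `&` [set w | g w = i]))).
  congr (mu _); apply/seteqP; split=> [w Bw|w [i _ []]//].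
  by exists (g w).
rewrite measure_fin_bigcup//.
  rewrite [RHS]bigfs//=.
  - by have -> : [set` predT] = [set: I] by apply/seteqP; split.
  - exact: index_enum_uniq.
  - by move=> i _; rewrite mem_index_enum.
  exact: finite_finset.
by move=> i k _ _ [w [[_ /= <-] [_ /= <-]]].
Qed.

Lemma probability_setI1 (d : measure_display) (T : measurableType d)
    (R : realType) (P : probability T R) (A B : set T) :
  measurable A -> measurable B -> P A = 1%E -> P (A `&` B) = P B.
Proof.
move=> mA mB PA; rewrite (measureDI P mB mA) setIC -[LHS]add0e; congr (_ + _)%E.
apply/esym/eqP; rewrite -measure_le0.
apply: (@le_trans _ _ (P (~` A))).
  apply: le_measure; rewrite ?inE//; first exact: measurableD.
    exact: measurableC.
by rewrite probability_setC// PA subee.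
Qed.

Context (d : measure_display) (T : measurableType d) (R : realType) (N : nat).
Context (Pi : 'I_N -> probability T R).
Context (J : nat -> T -> 'I_N) (Z : nat -> T -> nat).

Definition stepmx (m : nat) : 'M[R]_N := \matrix_(i, j) lambda Pi J Z i j m.

Definition hit_after (k n x : nat) (j : 'I_N) : set T :=
  [set w | first_passage (Z^~ w) k n x /\ J (k + n) w = j].

Context (hmeas : measurable_JZ J Z).

Lemma measurable_past n s z : measurable (past J Z n s z).
Proof.
have -> : past J Z n s z =
    \bigcap_k ([set w | (k <= n)%N -> J k w = s k] `&`
               [set w | (1 <= k <= n)%N -> Z k w = z k]).
  apply/seteqP; split=> [w [Js Zs] k _|w JZ].
    by split; [exact: Js|exact: Zs].
  by split=> k; [exact: (JZ k I).1|exact: (JZ k I).2].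
have mimp (b : bool) (A : set T) :
    (b -> measurable A) -> measurable [set w | b -> A w].
  case: b => [/(_ isT)|_].
    rewrite (_ : mkset _ = A)//; apply/seteqP; split=> w Aw; first exact: Aw.
    by move=> _; exact: Aw.
  by rewrite (_ : mkset _ = setT)//; apply/seteqP; split.
apply: bigcapT_measurable => k; apply: measurableI; apply: mimp => kn.
  exact: hmeas.1.
by apply: hmeas.2; case/andP: kn.
Qed.

Lemma measurable_first_passage k n x :
  measurable [set w | first_passage (Z^~ w) k n x].
Proof.
elim: n k x => [|n IHn] k [|x] /=; rewrite ?set_true ?set_false//.
have -> : [set w | first_passage (Z^~ w) k.+1 n (x + Z k.+1 w)] =
    \bigcup_m ([set w | Z k.+1 w = m] `&`
               [set w | first_passage (Z^~ w) k.+1 n (x + m)]).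
  apply/seteqP; split=> [w fp|w [m _ [/= -> //]]].
  by exists (Z k.+1 w).
by apply: bigcupT_measurable => m; apply: measurableI => //; exact: hmeas.2.
Qed.

Lemma measurable_hit_after k n x j : measurable (hit_after k n x j).
Proof.
by apply: measurableI; [exact: measurable_first_passage|exact: hmeas.1].
Qed.

Lemma first_passage_bound z k n x : first_passage z k n x -> (x <= n)%N.
Proof. by rewrite first_passageP => -[e _]; rewrite -[leqRHS]e leq_addr. Qed.

Lemma past_ext k s z m l :
  past J Z k.+1 [eta s with k.+1 |-> l] [eta z with k.+1 |-> m] =
  past J Z k s z `&` [set w | Z k.+1 w = m /\ J k.+1 w = l].
Proof.
apply/seteqP; split=> w.
  move=> [Js Zs]; split; [split|split] => [r rk|r /andP[r0 rk]||].
  - by rewrite Js ?(leqW rk)//= ltn_eqF.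
  - by rewrite Zs ?r0 ?(leqW rk)//= ltn_eqF.
  - by rewrite Zs ?leqnn//= eqxx.
  - by rewrite Js//= eqxx.
move=> [[Js Zs] /= [Zm Jl]]; split=> [r|r /andP[r0]] rk /=.
  by case: eqP => [->//|/eqP ne]; apply: Js; rewrite -ltnS ltn_neqAle ne.
by case: eqP => [->//|/eqP ne]; apply: Zs; rewrite r0 -ltnS ltn_neqAle ne.
Qed.

Context (hmap : markov_additive Pi J Z).

(** Markov property at time [k] for first passages.  Splitting on the next claim
and phase extends the past by one step, so the induction hypothesis applies at
time [k + 1] and [markov_additive] evaluates the extended past; quantifying over
all pasts makes any shift of time superfluous. *)
Lemma past_hit_after i j n k s z x :
  (Pi i (past J Z k s z `&` hit_after k n x j) =
   Pi i (past J Z k s z) * (hitmx stepmx n x (s k) j)%:E)%E.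
Proof.
elim: n k s z x => [|n IHn] k s z [|x].
- rewrite /hit_after /= mxE addn0; case: eqP => [<-|ne].
    rewrite mule1; congr (Pi i _); apply/seteqP; split=> w [] //.
    by move=> Js Zs; split=> //; split=> //; exact: Js.
  rewrite mule0 -[RHS](measure0 (Pi i)); congr (Pi i _).
  by apply/seteqP; split=> // w [[Js _] /= [_]]; rewrite Js.
- rewrite /= mxE mule0 -[RHS](measure0 (Pi i)); congr (Pi i _).
  by apply/seteqP; split=> // w [_ []].
- rewrite /= mxE mule0 -[RHS](measure0 (Pi i)); congr (Pi i _).
  by apply/seteqP; split=> // w [_ []].
(* inord loses nothing here: a passage in n more steps forces the claim <= n *)
pose g w : 'I_n.+1 * 'I_N := (inord (Z k.+1 w), J k.+1 w).
have decomp (m : 'I_n.+1) l :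
    past J Z k s z `&` hit_after k n.+1 x.+1 j `&` [set w | g w = (m, l)] =
    past J Z k.+1 [eta s with k.+1 |-> l] [eta z with k.+1 |-> (m : nat)] `&`
    hit_after k.+1 n (x + m) j.
  rewrite past_ext; apply/seteqP; split=> w.
    move=> [[pw [/= fp Jj]] [gm gl]].
    have Zm : Z k.+1 w = m.
      rewrite -gm inordK// ltnS.
      by apply: leq_trans (first_passage_bound fp); rewrite leq_addl.
    by do 2?split; rewrite // -?Zm// addSnnS.
  move=> [[pw [/= Zm Jl]] [fp Jj]]; split; first split=> //.
    by split; rewrite ?addnS//= Zm.
  by rewrite /g /= Zm Jl inord_val.
rewrite (@measure_partition _ _ _ _ _ g); last first.
  move=> [m l]; rewrite decomp; apply: measurableI.
    exact: measurable_past.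
  exact: measurable_hit_after.
transitivity (\sum_(p : 'I_n.+1 * 'I_N) Pi i (past J Z k s z) *
    (lambda Pi J Z (s k) p.2 p.1 * hitmx stepmx n (x + p.1) p.2 j)%:E)%E.
  apply: eq_bigr => -[m l] _.
  rewrite decomp; apply: etrans (IHn _ _ _ _) _.
  by rewrite past_ext hmap /= eqxx -muleA -EFinM.
rewrite -ge0_sume_distrr => [|[m l] _]; last first.
  rewrite lee_fin mulr_ge0 ?fine_ge0//; apply: hitmx_ge0 => *.
  by rewrite mxE fine_ge0.
congr (_ * _)%E; rewrite sumEFin; congr EFin.
rewrite -(pair_bigA _ (fun (m : 'I_n.+1) l => lambda Pi J Z (s k) l m *
   hitmx stepmx n (x + m) l j))/= summxE.
apply: eq_bigr => m _; rewrite mxE; apply: eq_bigr => l _.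
by rewrite mxE.
Qed.

Context (hinit : forall i, Pi i [set w | J 0%N w = i] = 1%E).

Lemma prob_hit i j n x :
  Pi i (hit_after 0 n x j) = (hitmx stepmx n x i j)%:E.
Proof.
have pastE : past J Z 0 (fun=> i) (fun=> 0%N) = [set w | J 0%N w = i].
  apply/seteqP; split=> w; first by case=> + _; apply.
  by move=> Ji; split=> [[]//|[]].
have := past_hit_after i j n 0 (fun=> i) (fun=> 0%N) x.
rewrite pastE hinit mul1e => <-; apply/esym/probability_setI1 => //.
  exact: hmeas.1.
exact: measurable_hit_after.
Qed.

(** At most one term of the series is nonzero, the one at the passage time. *)
Lemma discounted_indicatorE (v : R) x j w :
  0 <= v ->
  (discounted_indicator J v (tauhat Z x%:Z) j w)%:E =
  (\sum_(n <oo) (v ^+ n * \1_(hit_after 0 n x j) w)%:E)%E.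
Proof.
move=> v0; rewrite /discounted_indicator.
have c0 n : (0 <= (v ^+ n * \1_(hit_after 0 n x j) w : R)%:E)%E.
  by rewrite lee_fin mulr_ge0 ?exprn_ge0.
have hitE n : hit_after 0 n x j w <-> tauhat Z x%:Z w = Some n /\ J n w = j.
  by rewrite tauhatP /hit_after /= add0n.
case tauE: tauhat => [n|]; last first.
  rewrite eseries0// => n _ _; rewrite indicE memNset ?mulr0// hitE tauE.
  by case.
rewrite (nneseriesD1 (n := n))//= eseries0 ?adde0.
  rewrite indicE; case: eqP => Jj; last by rewrite memNset // hitE => -[].
  by rewrite mem_set// hitE.
move=> m _ mn; rewrite indicE memNset ?mulr0// hitE tauE => -[[nm] _].
by rewrite nm eqxx in mn.
Qed.

Lemma expectation_discounted (v : R) x i j : 0 <= v ->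
  ('E_(Pi i)[discounted_indicator J v (tauhat Z x%:Z) j] =
   \sum_(n <oo) (v ^+ n * hitmx stepmx n x i j)%:E)%E.
Proof.
move=> v0; rewrite unlock.
under eq_integral do rewrite discounted_indicatorE//.
have mi n : measurable_fun setT (EFin \o (\1_(hit_after 0 n x j) : T -> R)).
  apply/measurable_EFinP; exact/measurable_indic/measurable_hit_after.
rewrite integral_nneseries//.
- apply: eq_eseriesr => n _; under eq_integral do rewrite EFinM.
  rewrite ge0_integralZl//=; last by rewrite lee_fin exprn_ge0.
  rewrite integral_indic//; last exact: measurable_hit_after.
  by rewrite setIT EFinM; congr (_ * _)%E; exact: prob_hit.
  exact: mi.
- move=> n; apply/measurable_EFinP; apply: measurable_funM => //.
  exact/measurable_indic/measurable_hit_after.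
- by move=> n w _; rewrite lee_fin mulr_ge0 ?exprn_ge0.
Qed.

(** Discounting only decreases the terms, and without it the series is the
probability that the level is ever reached in phase [j]. *)
Lemma discounted_series_fin (v : R) x i j : 0 <= v <= 1 ->
  (\sum_(n <oo) (v ^+ n * hitmx stepmx n x i j)%:E)%E \is a fin_num.
Proof.
move=> /andP[v0 v1].
have t0 n : (0 <= (v ^+ n * hitmx stepmx n x i j)%:E)%E.
  by rewrite EFinM -prob_hit mule_ge0 ?lee_fin ?exprn_ge0.
have le n : ((v ^+ n * hitmx stepmx n x i j)%:E <= Pi i (hit_after 0 n x j))%E.
  rewrite prob_hit lee_fin ler_piMl ?exprn_ile1//.
  by rewrite -lee_fin -prob_hit.
rewrite ge0_fin_numE ?nneseries_ge0//.
apply: (@le_lt_trans _ _ (Pi i (\bigcup_n hit_after 0 n x j))); last first.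
  by rewrite (le_lt_trans (probability_le1 _ _)) ?ltry//;
    apply: bigcupT_measurable => n; exact: measurable_hit_after.
rewrite measure_semi_bigcup//.
- by apply: lee_nneseries => // n _; exact: le.
- by move=> n; exact: measurable_hit_after.
- by move=> n m _ _ [w [[/tauhatP tn _] [/tauhatP]]]; rewrite tn => -[].
- by apply: bigcupT_measurable => n; exact: measurable_hit_after.
Qed.

Lemma Phihat0 (v : R) : 0 <= v -> Phihat Pi J Z v 0 = 1%:M.
Proof.
move=> v0; apply/matrixP => i j; rewrite mxE expectation_discounted//.
rewrite (@nneseries_finite_support _ _ 1)//.
- by rewrite big_ord1 mul1r.
- by move=> [|n]; rewrite lee_fin mulr_ge0 ?exprn_ge0//= mxE ?ler0n.
- by move=> [|n]//= _; rewrite mxE mulr0.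
Qed.

(** Discounting is multiplicative in time, so the convolution over the epoch at
which level 1 is passed becomes a matrix product. *)
Lemma PhihatS (v : R) x : 0 <= v <= 1 ->
  Phihat Pi J Z v x.+1%:Z = G_ Pi J Z v *m Phihat Pi J Z v x%:Z.
Proof.
move=> v01; have v0 : 0 <= v by case/andP: v01.
have L0 m i j : 0 <= stepmx m i j by rewrite mxE fine_ge0.
have t0 n y i j : 0 <= v ^+ n * hitmx stepmx n y i j.
  by rewrite mulr_ge0 ?exprn_ge0 ?hitmx_ge0.
apply/matrixP => i j; rewrite [LHS]mxE [RHS]mxE expectation_discounted//.
transitivity (fine (\sum_l
    ((\sum_(n <oo) (v ^+ n * hitmx stepmx n 1 i l)%:E) *
     (\sum_(n <oo) (v ^+ n * hitmx stepmx n x l j)%:E)))%E).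
  congr fine; under [RHS]eq_bigr => l _.
    rewrite -nneseries_cauchy_product//; last exact: discounted_series_fin.
    over.
  rewrite /= -nneseries_sum => [|l n _]; last first.
    by rewrite lee_fin sumr_ge0// => k _; rewrite mulr_ge0.
  apply: eq_eseriesr => n _; rewrite sumEFin; congr EFin.
  rewrite -add1n hitmxD summxE mulr_sumr exchange_big/=.
  apply: eq_bigr => k _; rewrite mxE mulr_sumr; apply: eq_bigr => l _.
  by rewrite mulrACA -exprD subnKC// -ltnS.
rewrite -sum_fine => [|l _]; last by rewrite fin_numM// discounted_series_fin.
apply: eq_bigr => l _; rewrite fineM ?discounted_series_fin//.
by rewrite /G_ tau1_tauhat !mxE !expectation_discounted.
Qed.

End Probability.

(** * The Gerber-Shiu function *)

Theorem theorem7 (d : measure_display) (T : measurableType d) (R : realType)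
    (N : nat) (Pr : probability T R) (Pi : 'I_N -> probability T R)
    (J : nat -> T -> 'I_N) (Z : nat -> T -> nat) (pi : 'cV[R]_N)
    (hmeas : measurable_JZ J Z)
    (hcond : conditional_laws Pr Pi J)
    (hmap : markov_additive Pi J Z)
    (hmean : finite_mean_increments Pi J Z)
    (hirr : irreducible_chain Pi J)
    (hrec : positive_recurrent Pi J)
    (hpi : stationary_distribution Pi J pi)
    (hA1 : A_ Pi J Z 1 \in unitmx)
    (hnet : net_profit_dual Pi J Z pi)
    (v : R) (hv : 0 < v <= 1) (u : nat) :
  phihat Pr Pi J Z v u%:Z =
  ((initial_distribution Pr J)^T *m (G_ Pi J Z v ^+ u) *m const_mx 1
     : 'M[R]_1) 0 0.
Proof.
have v01 : 0 <= v <= 1 by case/andP: hv => /ltW -> ->.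
have Ji : forall i, Pi i [set w | J 0%N w = i]%classic = 1%E := hcond.1.
rewrite /phihat; congr ((_ *m _ *m _) _ _).
elim: u => [|u IHu].
  by rewrite expr0 Phihat0//; case/andP: v01.
by rewrite PhihatS// IHu exprS.
Qed.
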